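(* Let $E_1,E_2$ be propositional variables and $\delta$ a new atomic formula symbol. Write $\veebar$ for exclusive disjunction. Then $\mathsf{QLP}^-(\delta\leftrightarrow[E_1\wedge\neg(\exists x)x:(\delta\rightarrow E_1)]\veebar[E_2\wedge\neg(\exists x)x:(\delta\wedge\neg E_1\rightarrow E_2)])_{\emptyset}\nvdash\neg\delta$, where this logic is $\mathsf{QLP}^-$ without Axiom Necessitation, over the language extended by $\delta$, with that single additional axiom.
   Context: Fix countably many justification variables, propositional variables, and primitive function symbols of each arity $n\ge0$; a primitive term is $f(x_1,\dots,x_n)$. Terms of $\mathsf{QLP}^-$: $t::= x\mid f(x_1,\dots,x_n)\mid t\cdot t\mid t+t\mid !t$. Formulas: $A::= p\mid\bot\mid\neg A\mid A\wedge A\mid A\vee A\mid A\rightarrow A\mid t:A\mid(\forall x)A\mid(\exists x)A$. Axioms: all propositional tautologies; Q1: $(\forall x)A(x)\rightarrow A(t)$, $t$ free for $x$; Q2: $(\forall x)(A\rightarrow B(x))\rightarrow(A\rightarrow(\forall x)B(x))$, $x$ not free in $A$; Q3: $A(t)\rightarrow(\exists x)A(x)$, $t$ free for $x$; Q4: $(\forall x)(A(x)\rightarrow B)\rightarrow((\exists x)A(x)\rightarrow B)$, $x$ not free in $B$; jK: $s:(A\rightarrow B)\rightarrow(t:A\rightarrow(s\cdot t):B)$; jT: $t:A\rightarrow A$; j4: $t:A\rightarrow !t:t:A$; Sum: $s:A\rightarrow(s+t):A$, $s:A\rightarrow(t+s):A$. Rules: Modus Ponens; Gen: from $A$ infer $(\forall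 x)A$; Axiom Necessitation: from an axiom instance $A$ infer $f(x_1,\dots,x_n):A$. The subscript $\emptyset$ means Axiom Necessitation is dropped. All schemes and rules apply to formulas of the extended language. *)

(* Defs.v *)
From mathcomp Require Import all_boot.
Set Implicit Arguments.
Unset Strict Implicit.
Unset Printing Implicit Defensive.

Definition jvar := nat.
Definition pvar := nat.

(* [FunSym n k] is the k-th primitive function symbol of arity n. *)
Record funsym := FunSym { arity : nat; funsym_index : nat }.

(* The arguments of a primitive function symbol are variables, never compound
   terms. *)
Inductive term :=
| TVar of jvar
| TPrim (f : funsym) of (arity f).-tuple jvar
| TApp of term & term
| TSum of term & term
| TBang of term.

(* [At] is the type of atomic formulas other than falsity: [pvar] for the
   language of QLP^-, and [atom] below for its extension by delta. *)
Inductive formula (At : Type) :=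
| Atom of At
| Bot
| Neg of formula At
| And of formula At & formula At
| Or of formula At & formula At
| Imp of formula At & formula At
| Just of term & formula At
| All of jvar & formula At
| Ex of jvar & formula At.

Arguments Bot {At}.

Inductive atom := PVar of pvar | Delta.

Fixpoint term_vars (t : term) : seq jvar :=
  match t with
  | TVar x => [:: x]
  | TPrim _ xs => xs
  | TApp s t | TSum s t => term_vars s ++ term_vars t
  | TBang t => term_vars t
  end.

Fixpoint free_in At (x : jvar) (A : formula At) : bool :=
  match A with
  | Atom _ | Bot => false
  | Neg A => free_in x A
  | And A B | Or A B | Imp A B => free_in x A || free_in x B
  | Just t A => (x \in term_vars t) || free_in x A
  | All y A | Ex y A => (y != x) && free_in x A
  end.

(* Substitution is partial: replacing a variable argument of a primitive term
   by anything but a variable leaves the language. *)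
Fixpoint term_subst (x : jvar) (t s : term) : option term :=
  match s with
  | TVar y => Some (if y == x then t else s)
  | TPrim f xs =>
      if x \in val xs then
        if t is TVar z
        then Some (TPrim (map_tuple (fun y => if y == x then z else y) xs))
        else None
      else Some s
  | TApp s1 s2 =>
      if (term_subst x t s1, term_subst x t s2) is (Some r1, Some r2)
      then Some (TApp r1 r2) else None
  | TSum s1 s2 =>
      if (term_subst x t s1, term_subst x t s2) is (Some r1, Some r2)
      then Some (TSum r1 r2) else None
  | TBang s => omap TBang (term_subst x t s)
  end.

(* [subst x t A] is A(t), obtained by replacing the free occurrences of [x] by
   [t] without renaming bound variables; capture is excluded separately, by
   [free_for]. *)
Fixpoint subst At (x : jvar) (t : term) (A : formula At) :
    option (formula At) :=
  match A with
  | Atom _ | Bot => Some A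
  | Neg A => omap (@Neg At) (subst x t A)
  | And A B =>
      if (subst x t A, subst x t B) is (Some A', Some B')
      then Some (And A' B') else None
  | Or A B =>
      if (subst x t A, subst x t B) is (Some A', Some B')
      then Some (Or A' B') else None
  | Imp A B =>
      if (subst x t A, subst x t B) is (Some A', Some B')
      then Some (Imp A' B') else None
  | Just s A =>
      if (term_subst x t s, subst x t A) is (Some s', Some A')
      then Some (Just s' A') else None
  | All y B => if y == x then Some A else omap (All y) (subst x t B)
  | Ex y B => if y == x then Some A else omap (Ex y) (subst x t B)
  end.

Fixpoint free_for At (t : term) (x : jvar) (A : formula At) : bool :=
  match A with
  | Atom _ | Bot => true
  | Neg A | Just _ A => free_for t x A
  | And A B | Or A B | Imp A B => free_for t x A && free_for t x B
  | All y B | Ex y B =>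
      ~~ free_in x A || ((y \notin term_vars t) && free_for t x B)
  end.

(* Formulas that are not Boolean combinations (atoms, [t : A] and quantified
   formulas) are the propositional atoms of a tautology. *)
Fixpoint bool_eval At (v : formula At -> bool) (A : formula At) : bool :=
  match A with
  | Bot => false
  | Neg A => ~~ bool_eval v A
  | And A B => bool_eval v A && bool_eval v B
  | Or A B => bool_eval v A || bool_eval v B
  | Imp A B => bool_eval v A ==> bool_eval v B
  | Atom _ | Just _ _ | All _ _ | Ex _ _ => v A
  end.

Definition tautology At (A : formula At) : Prop :=
  forall v : formula At -> bool, bool_eval v A.

Declare Scope qlp_scope.
Delimit Scope qlp_scope with qlp.
Bind Scope qlp_scope with formula.

Definition Iff At (A B : formula At) := And (Imp A B) (Imp B A).
Definition Xor At (A B : formula At) := And (Or A B) (Neg (And A B)).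

Notation "~~ A" := (Neg A) : qlp_scope.
Notation "A && B" := (And A B) : qlp_scope.
Notation "A || B" := (Or A B) : qlp_scope.
Notation "A ==> B" := (Imp A B) : qlp_scope.
Notation "A <==> B" := (Iff A B) (at level 58, no associativity) : qlp_scope.
Notation "A (+) B" := (Xor A B) : qlp_scope.
Notation "t ::: A" := (Just t A) (at level 36, right associativity) : qlp_scope.
Notation "\all x , A" := (All x A) (at level 200, x at level 99) : qlp_scope.
Notation "\ex x , A" := (Ex x A) (at level 200, x at level 99) : qlp_scope.

Local Open Scope qlp_scope.

Inductive QLPminus_axiom At : formula At -> Prop :=
| Ax_taut A : tautology A -> QLPminus_axiom A
| Ax_Q1 x t A A' : free_for t x A -> subst x t A = Some A' ->
    QLPminus_axiom ((\all x, A) ==> A')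
| Ax_Q2 x A B : ~ free_in x A ->
    QLPminus_axiom ((\all x, A ==> B) ==> (A ==> \all x, B))
| Ax_Q3 x t A A' : free_for t x A -> subst x t A = Some A' ->
    QLPminus_axiom (A' ==> \ex x, A)
| Ax_Q4 x A B : ~ free_in x B ->
    QLPminus_axiom ((\all x, A ==> B) ==> ((\ex x, A) ==> B))
| Ax_jK s t A B :
    QLPminus_axiom (s ::: (A ==> B) ==> (t ::: A ==> TApp s t ::: B))
| Ax_jT t A : QLPminus_axiom (t ::: A ==> A)
| Ax_j4 t A : QLPminus_axiom (t ::: A ==> TBang t ::: t ::: A)
| Ax_SumL s t A : QLPminus_axiom (s ::: A ==> TSum s t ::: A)
| Ax_SumR s t A : QLPminus_axiom (s ::: A ==> TSum t s ::: A).

(* [QLPminus_empty D A] : A is a theorem of QLP^-(D) without Axiom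
   Necessitation, D being the single additional axiom (not a scheme). *)
Inductive QLPminus_empty At (D : formula At) : formula At -> Prop :=
| QLP_axiom A : QLPminus_axiom A -> QLPminus_empty D A
| QLP_extra : QLPminus_empty D D
| QLP_MP A B : QLPminus_empty D (A ==> B) -> QLPminus_empty D A ->
    QLPminus_empty D B
| QLP_Gen x A : QLPminus_empty D A -> QLPminus_empty D (\all x, A).

Definition prop (p : pvar) : formula atom := Atom (PVar p).
Definition delta : formula atom := Atom Delta.

(* Main.v *)
(** All atoms are true, quantifiers are vacuous, and [t ::: A] holds, whatever
    [t] is, iff [A] is [s1 ::: ... ::: sn ::: (delta ==> E1)] for some terms
    [s1], ..., [sn]. These formulas are true, closed under [s ::: _], stable
    under substitution, and never the two premises of a modus ponens, so this
    is a model of all axioms but Axiom Necessitation. In it the first side of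
    the exclusive disjunction fails, the second one holds, and so does
    [delta]. *)
Require Import Defs.
From mathcomp Require Import all_boot.
Local Open Scope qlp_scope.

Fixpoint justified (E : pvar) (A : formula atom) : bool :=
  match A with
  | Imp (Atom Delta) (Atom (PVar e)) => e == E
  | Just _ B => justified E B
  | _ => false
  end.

Fixpoint holds (E : pvar) (A : formula atom) : bool :=
  match A with
  | Atom _ => true
  | Bot => false
  | Neg A => negb (holds E A)
  | And A B => andb (holds E A) (holds E B)
  | Or A B => orb (holds E A) (holds E B)
  | Imp A B => implb (holds E A) (holds E B)
  | Just _ A => justified E A
  | All _ A | Ex _ A => holds E A
  end.

(** [holds] commutes with the connectives, so used as a valuation it reproduces itself; this makes
    tautologies true in the model. *)
Lemma bool_eval_holds E A : bool_eval (holds E) A = holds E A.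
Proof. by elim: A => //= [A -> | A -> B -> | A -> B -> | A -> B ->]. Qed.

Lemma justified_holds E A : justified E A -> holds E A.
Proof. by elim: A => //= A _ B _; case: A => // -[] //; case: B. Qed.

(** A justified implication has antecedent [delta], and no atom is justified. *)
Lemma justified_mp E A B :
  justified E (A ==> B) -> justified E A -> justified E B.
Proof. by case: A. Qed.

(** Substitution preserves the outermost constructor and leaves atoms alone. *)
Lemma subst_Atom At x t (A : formula At) a :
  subst x t A = Some (Atom a) -> A = Atom a.
Proof.
case: A => //=.
- by move=> b [->].
- by move=> A; case: subst.
- by move=> A B; case: subst => // ?; case: subst.
- by move=> A B; case: subst => // ?; case: subst.
- by move=> A B; case: subst => // ?; case: subst.
- by move=> s A; case: term_subst => // ?; case: subst.
- by move=> y A; case: ifP => // _; case: subst.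
- by move=> y A; case: ifP => // _; case: subst.
Qed.

Lemma justified_Imp E A B :
  reflect (A = delta /\ B = prop E) (justified E (A ==> B)).
Proof.
apply: (iffP idP) => [|[-> ->]]; last by rewrite /= eqxx.
by case: A => // -[] //; case: B => // -[] //= e /eqP ->.
Qed.

(** An equality rather than one implication, since [holds_subst] needs it below negations and to the
    left of implications. *)
Lemma justified_subst E x t A A' :
  subst x t A = Some A' -> justified E A' = justified E A.
Proof.
elim: A A' => //=.
- by move=> a A' [<-].
- by move=> A' [<-].
- by move=> A _ A'; case: subst => //= ? [<-].
- by move=> A _ B _ A'; case: subst => // ?; case: subst => // ? [<-].
- by move=> A _ B _ A'; case: subst => // ?; case: subst => // ? [<-].
- move=> A _ B _ C; case eA: subst => [A'|] //; case eB: subst => [B'|] // [<-].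
  (* Only here does [justified] inspect two levels: [subst_Atom] recovers the atoms before
     substitution, and conversely atoms are unchanged by it. *)
  apply/justified_Imp/justified_Imp => [[eA' eB']|[eA' eB']]; subst.
    by rewrite (subst_Atom _ _ _ _ _ eA) (subst_Atom _ _ _ _ _ eB).
  by case: eA eB => <- [<-].
- move=> s A IH A'; case: term_subst => // ?; case eA: subst => // -[<-] /=.
  exact: IH.
- by move=> y A _ A'; case: ifP => _; [move=> [<-]|case: subst => //= ? [<-]].
- by move=> y A _ A'; case: ifP => _; [move=> [<-]|case: subst => //= ? [<-]].
Qed.

Lemma holds_subst E x t A A' :
  subst x t A = Some A' -> holds E A' = holds E A.
Proof.
elim: A A' => //=.
- by move=> a A' [<-].
- by move=> A' [<-].
- by move=> A IH A'; case: subst IH => //= ? /(_ _ erefl) <- [<-].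
- move=> A IHA B IHB A'; case: subst IHA => // ? /(_ _ erefl) <-.
  by case: subst IHB => // ? /(_ _ erefl) <- [<-].
- move=> A IHA B IHB A'; case: subst IHA => // ? /(_ _ erefl) <-.
  by case: subst IHB => // ? /(_ _ erefl) <- [<-].
- move=> A IHA B IHB A'; case: subst IHA => // ? /(_ _ erefl) <-.
  by case: subst IHB => // ? /(_ _ erefl) <- [<-].
- move=> s A _ A'; case: term_subst => // ?; case eA: subst => // -[<-] /=.
  exact: justified_subst eA.
- move=> y A IH A'; case: ifP => _; first by move=> [<-].
  by case: subst IH => //= ? /(_ _ erefl) <- [<-].
- move=> y A IH A'; case: ifP => _; first by move=> [<-].
  by case: subst IH => //= ? /(_ _ erefl) <- [<-].
Qed.

(** With vacuous quantifiers and terms ignored, Q1 to Q4, j4 and Sum all take the form of a truth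
    value implying itself. Only jK and jT use the choice of justified formulas. *)
Lemma axiom_holds E A : QLPminus_axiom A -> holds E A.
Proof.
case=> {A}.
- by move=> A /(_ (holds E)); rewrite bool_eval_holds.
- by move=> x t A A' _ eA; rewrite /= (holds_subst _ _ _ _ _ eA) implybb.
- by move=> x A B _; rewrite /= implybb.
- by move=> x t A A' _ eA; rewrite /= (holds_subst _ _ _ _ _ eA) implybb.
- by move=> x A B _; rewrite /= implybb.
- by move=> s t A B; apply/implyP => jAB; apply/implyP; apply: justified_mp jAB.
- by move=> t A; apply/implyP; apply: justified_holds.
- by move=> t A; rewrite /= implybb.
- by move=> s t A; rewrite /= implybb.
- by move=> s t A; rewrite /= implybb.
Qed.

Lemma soundness E D A : holds E D -> QLPminus_empty D A -> holds E A.
Proof.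
move=> hD; elim=> {A} // [A /axiom_holds -> | A B _ /= + _ hA] //.
by rewrite hA.
Qed.

Theorem theorem30 (E1 E2 : pvar) (x : jvar) :
  ~ QLPminus_empty
      (delta <==>
         ((prop E1 && ~~ (\ex x, TVar x ::: (delta ==> prop E1)))
          (+)
          (prop E2 && ~~ (\ex x, TVar x ::: (delta && ~~ prop E1 ==> prop E2)))))
      (~~ delta).
(* The formula in the second bracket has a conjunction as antecedent, so it is not justified even
   when [E1] and [E2] coincide. *)
Proof. by move/(soundness E1) => /=; rewrite eqxx => /(_ isT). Qed.
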